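(* Let $(G,S)$ be a Cayley graph of a group of polynomial growth with homogeneous dimension $N\geq 3$, let $1<p<\frac N2$ and $q>p^{\ast\ast}:=\frac{Np}{N-2p}$, and let $$K:=\inf\{\lVert u\rVert_{D^{2,p}(G)}^p : u\in D^{2,p}(G),\ \lVert u\rVert_{\ell^q(G)}=1\}.$$ Let $\{u_n\}\subset D^{2,p}(G)$ be a minimizing sequence, i.e. $\lVert u_n\rVert_{\ell^q(G)}=1$ for all $n$ and $\lVert u_n\rVert_{D^{2,p}(G)}^p\to K$ as $n\to\infty$. Then there exist a sequence $\{x_n\}\subset G$ and $v\in D^{2,p}(G)$ such that the translated sequence $v_n(x):=u_n(x_nx)$ contains a subsequence converging to $v$ in $D^{2,p}(G)$ (i.e. in the norm $\lVert\cdot\rVert_{D^{2,p}(G)}$). Moreover, $v$ is a minimizer for $K$, i.e. $\lVert v\rVert_{\ell^q(G)}=1$ and $\lVert v\rVert_{D^{2,p}(G)}^p=K$.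
   Context: $G$ is a finitely generated group and $S$ a finite generating set with $S=S^{-1}$. The Cayley graph $(G,S)$ has vertex set $G$, and $x\sim y$ iff $x=ys$ for some $s\in S$. $\beta_S(n)$ is the number of elements of $G$ at word distance at most $n$ from the unit element. $G$ is of polynomial growth with homogeneous dimension $N\in\mathbb N$ if there are constants $C_1,C_2>0$ depending on $S$ with $C_1n^N\le\beta_S(n)\le C_2n^N$ for all $n\ge1$. For $u:G\to\mathbb R$, $\Delta u(x):=\sum_{y\sim x}(u(y)-u(x))$, $\lVert u\rVert_{D^{2,p}(G)}:=\lVert\Delta u\rVert_{\ell^p(G)}$, and $D^{2,p}(G):=\{u\in\ell^{\frac{Np}{N-2p}}(G):\lVert u\rVert_{D^{2,p}(G)}<\infty\}$. Here $\ell^p(G)$ is taken with respect to the counting measure. *)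

(* Defs.v *)
From HB Require Import structures.
From mathcomp Require Export all_boot all_order all_algebra.
From mathcomp Require Export finmap all_classical all_reals all_analysis.

Set Implicit Arguments.
Unset Strict Implicit.
Unset Printing Implicit Defensive.

Import Order.TTheory GRing.Theory Num.Theory.
Import numFieldNormedType.Exports.

Local Open Scope classical_set_scope.
Local Open Scope ring_scope.

Section CayleyGraph.
Variable G : groupType.
Implicit Types (S : set G) (x y : G) (n N : nat).

Definition symmetric_set S : Prop := S = [set s^-1%g | s in S].

Definition generating S : Prop :=
  forall x, exists2 w : seq G,
    (forall s, s \in w -> S s \/ S s^-1%g) & (\prod_(s <- w) s)%g = x.

Definition cayley_adj S x y : Prop := exists2 s, S s & x = (y * s)%g.

(* For symmetric S, word distance at most n from the unit element means being
   a product of at most n elements of S. *)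
Definition word_ball S n : set G :=
  [set x | exists w : seq G,
    [/\ forall s, s \in w -> S s, (size w <= n)%N & (\prod_(s <- w) s)%g = x]].

(* fset_set sends infinite sets to the empty one, but balls are finite as soon
   as S is. *)
Definition growth S n : nat := #|` fset_set (word_ball S n)|.

Definition polynomial_growth (R : realType) S N : Prop :=
  exists C1 C2 : R, [/\ 0 < C1, 0 < C2 & forall n, (1 <= n)%N ->
    C1 * n%:R ^+ N <= (growth S n)%:R <= C2 * n%:R ^+ N].

Variable R : realType.
Implicit Types (p : R) (u : G -> R).

(* The sum ranges over the distinct neighbours of x, a finite set when S is
   finite. *)
Definition laplacian S u x : R :=
  \sum_(y \in [set y | cayley_adj S y x]) (u y - u x).

(* Only used for exponents p > 0; the value is +oo when u is not in l^p. *)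
Definition lpnorm p u : \bar R :=
  ((\esum_(x in [set: G]) (`|u x| `^ p)%:E) `^ p^-1)%E.

Definition critical_exponent N p : R := N%:R * p / (N%:R - 2 * p).

Definition D2norm S p u : \bar R := lpnorm p (laplacian S u).

Definition D2space S N p : set (G -> R) :=
  [set u | (lpnorm (critical_exponent N p) u < +oo)%E /\
           (D2norm S p u < +oo)%E].

Definition sobolev_inf S N p q : \bar R :=
  ereal_inf [set (D2norm S p u `^ p)%E |
              u in [set u | D2space S N p u /\ lpnorm q u = 1%E]].

End CayleyGraph.

(* Main.v *)
Require Import Defs.
From mathcomp Require Import ring lra zify.
Set Implicit Arguments.
Unset Strict Implicit.
Unset Printing Implicit Defensive.
Import Order.TTheory GRing.Theory Num.Theory.
Import numFieldNormedType.Exports.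
Local Open Scope classical_set_scope.
Local Open Scope ring_scope.

(** Write sigma for the critical exponent p** and Delta for the Laplacian.

    The proof rests on the second-order Sobolev inequality
    |u|_sigma <= C |Delta u|_p for u in l^sigma ([sobolev_inequality]), obtained
    here level by level.  For a finitely supported phi, a ball with twice as
    many points as the support carries phi off its support at least half of the
    time, while moving phi by a word of length r changes it by at most r times
    the square root of its Dirichlet energy in l^2.  This bounds the number of
    points where phi is large by r^2 times the energy ([capacity_bound]), with
    r of order |supp phi|^(1/N) by the growth hypothesis.  Take for phi the part
    of u lying between the heights t and 2t: summation by parts bounds its
    energy by 2t times the sum of |Delta u| over {|u| > t}, because truncation
    is monotone and 1-Lipschitz ([energy_trunc]).  With n(t) = #{|u| > t} this
    gives t n(2t) <= C n(t)^(2/N) sum_{|u| > t} |Delta u|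
    ([level_inequality]); summing over dyadic heights t, bounding one factor
    n(t)^(2/N) by Chebyshev's inequality, and splitting the product of
    |Delta u| with a power of |u| by Young's inequality yields the Sobolev
    inequality, the finiteness of |u|_sigma being used to absorb a term.

    The Sobolev inequality makes K positive, bounds the minimizing sequence in
    l^sigma, and, as q > sigma, prevents it from vanishing uniformly
    ([nonvanishing]): after translation, |v_n(1)| >= c > 0.  Let U be an
    ultrafilter on nat finer than the filter of neighbourhoods of infinity.
    All bounded real sequences converge along U, so no diagonal extraction is
    needed: v_n converges pointwise to some v along U, and the masses of
    w_n = v_n - v and of Delta w_n converge too.  The Brezis-Lieb lemma splits
    both masses: 1 = alpha + beta in l^q and K = D + E for the Laplacians in
    l^p, where alpha and D belong to v, beta and E to w_n.  By homogeneity
    K alpha^(p/q) <= D and K beta^(p/q) <= E, so that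
    alpha^(p/q) + beta^(p/q) <= 1 = alpha + beta with p/q < 1 and alpha > 0.
    Strict concavity forces alpha = 1, hence D = K and E = 0: v is a minimizer
    and Delta w_n tends to 0 in l^p along U, hence along a subsequence. *)

(** * Finite sums and the Dirichlet energy *)

Lemma sumT_shift (R : realType) (G : groupType) (f : G -> R) (y : G) :
  \sum_(x \in [set: G]) f (x * y)%g = \sum_(x \in [set: G]) f x.
Proof.
rewrite [RHS](@reindex_fsbigT _ _ _ _ _ (fun x => (x * y)%g))//.
by exists (fun x => (x * y^-1)%g) => x /=; rewrite (mulgK, mulgVK).
Qed.

Lemma sumT_fset (R : realType) (G : choiceType) (D : {fset G}) (f : G -> R) :
  (forall x, f x != 0 -> x \in D) ->
  \sum_(x \in [set: G]) f x = \sum_(x <- D) f x.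
Proof.
move=> fD; apply: fsbigTE => x; apply: contraNeq; exact: fD.
Qed.

Lemma sum_fset_sub (R : realType) (G : choiceType) (A D : {fset G}) (f : G -> R) :
  (A `<=` D)%fset -> (forall x, 0 <= f x) ->
  \sum_(x <- A) f x <= \sum_(x <- D) f x.
Proof.
move=> AD f0; rewrite (big_fsetID _ (mem A) D)/=.
rewrite (_ : [fset x in D | x \in A]%fset = A); last first.
  by apply/fsetP => x; rewrite !inE/= andb_idl//; exact: (fsubsetP AD).
by rewrite lerDl sumr_ge0.
Qed.

Lemma sum_fset_const (R : realType) (G : choiceType) (A : {fset G}) (c : R) :
  \sum_(x <- A) c = #|` A|%:R * c.
Proof. by rewrite big_const_seq count_predT iter_addr addr0 mulr_natl. Qed.

Section Capacity.
Variables (R : realType) (G : groupType).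
Implicit Types (S : set G) (phi : G -> R) (D A : {fset G}).

Definition energy S phi : R :=
  \sum_(s <- fset_set S) \sum_(x \in [set: G]) (phi (x * s)%g - phi x) ^+ 2.

(** Contains the supports of phi and of its translate x |-> phi (x y), when D
    contains the support of phi. *)
Definition shift_supp D (y : G) : {fset G} :=
  (D `|` [fset (x * y^-1)%g | x in D])%fset.

Lemma mem_shift_supp phi D y x : (forall x, phi x != 0 -> x \in D) ->
  (phi (x * y)%g != 0) || (phi x != 0) -> x \in shift_supp D y.
Proof.
move=> phiD; rewrite /shift_supp inE => /orP[/phiD xyD|/phiD->//].
apply/orP; right; apply/imfsetP; exists (x * y)%g => //.
by rewrite mulgK.
Qed.

Lemma sumT_shift_supp phi D y (f : G -> R) :
  (forall x, phi x != 0 -> x \in D) ->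
  (forall x, phi (x * y)%g = 0 -> phi x = 0 -> f x = 0) ->
  \sum_(x \in [set: G]) f x = \sum_(x <- shift_supp D y) f x.
Proof.
move=> phiD f0; apply: fsbigTE => x xD.
by apply: f0; apply/eqP; apply: contraNT xD => h;
   apply: (mem_shift_supp phiD); rewrite h ?orbT.
Qed.

(** Telescoping along the word and Cauchy-Schwarz.  One letter moves phi by at
    most the square root of the energy in l^2, and the sum over the group is
    invariant under translation, so n letters cost n^2 times the energy. *)
Lemma energy_translate S phi D (w : seq G) : finite_set S ->
  (forall x, phi x != 0 -> x \in D) ->
  (forall s, s \in w -> S s) ->
  \sum_(x \in [set: G]) (phi (x * \prod_(s <- w) s)%g - phi x) ^+ 2
    <= (size w)%:R ^+ 2 * energy S phi.
Proof.
move=> finS phiD.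
have E1 s : S s ->
    \sum_(x \in [set: G]) (phi (x * s)%g - phi x) ^+ 2 <= energy S phi.
  move=> Ss; rewrite /energy (big_fsetD1 (A := fset_set S) s)/=; last first.
    by rewrite in_fset_set// inE.
  by rewrite lerDl sumr_ge0// => i _; apply: fsumr_ge0 => x _; rewrite sqr_ge0.
elim: w => [|s w ih] wS.
  by rewrite fsbig1 ?expr0n ?mul0r// => x _; rewrite big_nil mulg1 subrr expr0n.
have Ss : S s by apply: wS; rewrite inE eqxx.
have /ih{ih} ih : forall s, s \in w -> S s.
  by move=> z zw; apply: wS; rewrite inE zw orbT.
rewrite big_cons /=; set y := (\prod_(j <- w) j)%g in ih *.
have [w0|w0] := posnP (size w).
  have -> : y = 1%g by rewrite /y (size0nil w0) big_nil.
  rewrite w0 mulg1 expr1n mul1r.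
  exact: E1.
set m : R := (size w)%:R; have m0 : 0 < m by rewrite ltr0n.
rewrite -natr1 -/m.
set F := (shift_supp D (s * y)%g `|` shift_supp D s)%fset.
have phi0 z x : x \notin shift_supp D z -> phi (x * z)%g = 0 /\ phi x = 0.
  move=> xD; split; apply/eqP; apply: contraNT xD => h;
    by apply: (mem_shift_supp phiD); rewrite h ?orbT.
have FP x : x \notin F ->
    [/\ phi (x * (s * y))%g = 0, phi (x * s)%g = 0 & phi x = 0].
  by rewrite inE negb_or => /andP[/phi0[-> ->] /phi0[-> _]].
have FT (f : G -> R) : (forall x, phi (x * (s * y))%g = 0 -> phi (x * s)%g = 0 ->
    phi x = 0 -> f x = 0) -> \sum_(x \in [set: G]) f x = \sum_(x <- F) f x.
  by move=> f0; apply: fsbigTE => x /FP[? ? ?]; exact: f0.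
have := ih; rewrite -(sumT_shift _ s) => ih'.
have {}ih' : \sum_(x <- F) (phi (x * (s * y))%g - phi (x * s)%g) ^+ 2
    <= m ^+ 2 * energy S phi.
  rewrite -FT; last by move=> x -> ->; rewrite subrr expr0n.
  by under eq_fsbigr do rewrite mulgA.
have := E1 _ Ss; rewrite FT; last by move=> x _ -> ->; rewrite subrr expr0n.
move=> E1s.
rewrite FT; last by move=> x -> _ ->; rewrite subrr expr0n.
rewrite -(ler_pM2l m0).
apply: (@le_trans _ _ (\sum_(x <- F) ((m + 1) *
  (phi (x * (s * y))%g - phi (x * s)%g) ^+ 2 +
  m * (m + 1) * (phi (x * s)%g - phi x) ^+ 2))).
  rewrite mulr_sumr; apply: ler_sum => x _.
  set a := phi (x * (s * y))%g; set b := phi (x * s)%g; set c := phi x.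
  rewrite -subr_ge0.
  have -> : (m + 1) * (a - b) ^+ 2 + m * (m + 1) * (b - c) ^+ 2 - m * (a - c) ^+ 2
    = ((a - b) - m * (b - c)) ^+ 2 by ring.
  exact: sqr_ge0.
rewrite big_split /= -!mulr_sumr.
have : (m + 1) * \sum_(x <- F) (phi (x * (s * y))%g - phi (x * s)%g) ^+ 2
   <= (m + 1) * (m ^+ 2 * energy S phi) by rewrite ler_pM2l// addr_gt0.
have : m * (m + 1) * \sum_(x <- F) (phi (x * s)%g - phi x) ^+ 2
   <= m * (m + 1) * energy S phi by rewrite ler_pM2l// mulr_gt0// addr_gt0.
move=> h1 h2; apply: le_trans (lerD h2 h1) _.
by rewrite le_eqVlt; apply/orP; left; apply/eqP; ring.
Qed.

(** Count pairs (x, y) with x in A and y in the ball of radius r.  For each x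
    the translate x y leaves D for at least half of the y, because D has at most
    half as many points as the ball, and then phi jumps from at least t to 0.
    For each y the total squared jump is at most r^2 times the energy. *)
Lemma capacity_bound S phi D A (t : R) (r : nat) : finite_set S ->
  (0 < growth S r)%N ->
  (forall x, phi x != 0 -> x \in D) ->
  (2 * #|` D| <= growth S r)%N ->
  0 <= t -> (forall x, x \in A -> t <= `|phi x|) ->
  #|` A|%:R * t ^+ 2 <= 2 * r%:R ^+ 2 * energy S phi.
Proof.
move=> finS; rewrite /growth; set B := fset_set _ => B0 phiD DB t0 At.
have finB : finite_set (word_ball S r).
  apply: contrapT => infB; move: B0; rewrite /B.
  by rewrite /fset_set; case: pselect => // _; rewrite cardfs0.
have BE : \sum_(y <- B) \sum_(x \in [set: G]) (phi (x * y)%g - phi x) ^+ 2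
    <= #|` B|%:R * (r%:R ^+ 2 * energy S phi).
  rewrite -sum_fset_const big_seq [leRHS]big_seq; apply: ler_sum => y yB.
  have [w [wS wr <-]] : word_ball S r y by move: yB; rewrite in_fset_set ?inE.
  apply: le_trans (energy_translate finS phiD wS) _.
  have E0 : 0 <= energy S phi.
    by apply: sumr_ge0 => s _; apply: fsumr_ge0 => x _; exact: sqr_ge0.
  by rewrite ler_wpM2r// ler_sqr ?nnegrE ?ler_nat.
have far x : x \in A -> #|` B|%:R * t ^+ 2 <=
    2 * \sum_(y <- B) (phi (x * y)%g - phi x) ^+ 2.
  move=> xA.
  pose B' := [fset y in B | phi (x * y)%g == 0]%fset.
  have B'B : (B' `<=` B)%fset by exact: fset_sub.
  have cardB' : (#|` B| <= 2 * #|` B'|)%N.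
    have : (#|` (B `\` B')%fset| <= #|` D|)%N.
      have /eqP <- : #|` [fset (x * y)%g | y in B `\` B']%fset|
          == #|` (B `\` B')%fset|.
        by apply/card_in_imfsetP => y z _ _ /mulgI.
      apply: fsubset_leq_card; apply/fsubsetP => _ /imfsetP[y /= + ->].
      by rewrite !inE/= => /andP[+ yB]; rewrite yB/= => /phiD.
    have := cardfsDS B'B; have := fsubset_leq_card B'B; lia.
  apply: (@le_trans _ _ (2 * (#|` B'|%:R * t ^+ 2))).
    by rewrite mulrA ler_wpM2r ?sqr_ge0// -natrM ler_nat.
  rewrite ler_pM2l//.
  apply: le_trans (sum_fset_sub B'B _); last by move=> y; exact: sqr_ge0.
  rewrite -sum_fset_const big_seq [leRHS]big_seq; apply: ler_sum => y.
  rewrite !inE/= => /andP[_ /eqP ->].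
  by rewrite sub0r sqrrN -[leRHS]real_normK ?num_real// ler_sqr ?nnegrE ?At.
have B0' : 0 < #|` B|%:R :> R by rewrite ltr0n.
rewrite -(ler_pM2l B0').
apply: (@le_trans _ _ (2 * (\sum_(x <- A) \sum_(y <- B) (phi (x * y)%g - phi x) ^+ 2))).
  rewrite mulrCA -sum_fset_const mulr_sumr big_seq [leRHS]big_seq.
  by apply: ler_sum => x /far.
have -> : #|` B|%:R * (2 * r%:R ^+ 2 * energy S phi) =
  2 * (#|` B|%:R * (r%:R ^+ 2 * energy S phi)) by ring.
rewrite ler_pM2l//; apply: le_trans BE.
rewrite exchange_big/=; apply: ler_sum => y _.
rewrite (sumT_fset (D := A `|` shift_supp D y)%fset).
  by apply: sum_fset_sub => [|x]; [exact: fsubsetUl|exact: sqr_ge0].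
move=> x; rewrite inE; apply: contraNT; rewrite negb_or => /andP[_ xD].
rewrite sqrf_eq0; have [->|px] := eqVneq (phi x) 0.
  have [->|pxy] := eqVneq (phi (x * y)%g) 0; first by rewrite subrr.
  by case/negP: xD; apply: (mem_shift_supp phiD); rewrite pxy.
by case/negP: xD; apply: (mem_shift_supp phiD); rewrite px orbT.
Qed.
End Capacity.

(** * Truncation and summation by parts *)

Section Truncation.
Variable R : realType.
Implicit Types t z w : R.

(** The part of z between heights t and 2t, with the sign of z. *)
Definition trunc t z : R :=
  if z < - (2 * t) then - t else if z < - t then z + t else
  if z <= t then 0 else if z <= 2 * t then z - t else t.

Lemma trunc_norm_le t z : 0 < t -> `|trunc t z| <= t.
Proof.
move=> t0; rewrite /trunc ler_norml.
do 4?case: ifPn; rewrite -?(ltNge, leNgt) => *; apply/andP; split; lra.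
Qed.

Lemma trunc_neq0 t z : 0 < t -> trunc t z != 0 -> t < `|z|.
Proof.
move=> t0; rewrite /trunc lter_normr.
do 4?case: ifPn; rewrite -?(ltNge, leNgt) ?eqxx// => *; apply/orP; lra.
Qed.

Lemma trunc_norm_ge t z : 0 < t -> 2 * t < `|z| -> t <= `|trunc t z|.
Proof.
move=> t0; rewrite /trunc !lter_normr.
do 4?case: ifPn; rewrite -?(ltNge, leNgt) => h1 *; apply/orP; lra.
Qed.

(** Both monotonicity and the Lipschitz constant 1 of the truncation: this is
    what lets the energy of the truncated function be tested against the
    Laplacian of the original one. *)
Lemma trunc_lip t z w : 0 < t ->
  (trunc t z - trunc t w) ^+ 2 <= (z - w) * (trunc t z - trunc t w).
Proof.
move=> t0; wlog wz : z w / w <= z => [H|].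
  have [/H//|/ltW/H] := leP w z.
  by rewrite -sqrrN opprB -(opprB z w) -(opprB (trunc t z)) mulrNN.
suff /andP[h1 h2] : 0 <= trunc t z - trunc t w <= z - w.
  by rewrite expr2 ler_wpM2r.
rewrite /trunc.
by do 8?case: ifPn; rewrite -?(ltNge, leNgt) => *; apply/andP; split; lra.
Qed.

End Truncation.

Section Laplacian.
Variables (R : realType) (G : groupType) (S : set G).
Implicit Types (u phi : G -> R).
Hypotheses (finS : finite_set S) (symS : symmetric_set S).

Lemma laplacianE u x :
  laplacian S u x = \sum_(s <- fset_set S) (u (x * s)%g - u x).
Proof.
rewrite -(fsbig_finite _ (fun s => u (x * s)%g - u x))//.
rewrite /laplacian.
rewrite (_ : [set y | _] = (fun s => (x * s)%g) @` S).
  by rewrite fsbig_image// => y z _ _ /mulgI.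
by apply/seteqP; split=> y [s Ss]; [move=> ->|move=> <-]; exists s.
Qed.

Lemma symmetric_setV s : S s -> S s^-1%g.
Proof. by move=> Ss; rewrite symS; exists s. Qed.

Lemma sum_symmetric (h : G -> R) :
  \sum_(s <- fset_set S) h s^-1%g = \sum_(s <- fset_set S) h s.
Proof.
rewrite -!fsbig_finite// [RHS](@reindex_fsbig _ _ _ _ _ (fun s => s^-1%g) S)//.
split=> [s /symmetric_setV//|s t _ _ /invg_inj//|s Ss].
by exists s^-1%g; [exact: symmetric_setV|rewrite invgK].
Qed.

(** Every edge is counted twice, once from each endpoint, because S is stable
    under inversion. *)
Lemma summation_by_parts u phi (D : {fset G}) :
  (forall x, phi x != 0 -> x \in D) ->
  \sum_(s <- fset_set S)
     \sum_(x \in [set: G]) (u (x * s)%g - u x) * (phi (x * s)%g - phi x)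
  = - 2 * \sum_(x \in [set: G]) laplacian S u x * phi x.
Proof.
move=> phiD.
have phi0 x : x \notin D -> phi x = 0.
  by move=> xD; apply/eqP; apply: contraNT xD => /phiD.
have -> : \sum_(x \in [set: G]) laplacian S u x * phi x =
    \sum_(s <- fset_set S) \sum_(x \in [set: G]) (u (x * s)%g - u x) * phi x.
  rewrite (sumT_fset (D := D)); last first.
    by move=> x; rewrite mulf_eq0 negb_or => /andP[_ /phiD].
  under eq_bigr do rewrite laplacianE mulr_suml.
  rewrite exchange_big/=; apply: eq_bigr => s _.
  rewrite (sumT_fset (D := D))// => x.
  by rewrite mulf_eq0 negb_or => /andP[_ /phiD].
have splitE s : \sum_(x \in [set: G]) (u (x * s)%g - u x) * (phi (x * s)%g - phi x)
    = - (\sum_(x \in [set: G]) (u (x * s^-1)%g - u x) * phi x)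
      - \sum_(x \in [set: G]) (u (x * s)%g - u x) * phi x.
  rewrite -(sumT_shift (fun x => (u (x * s^-1)%g - u x) * phi x) s).
  under [X in - X - _]eq_fsbigr do rewrite mulgK.
  rewrite !(sumT_shift_supp (y := s) phiD);
    [|by move=> x h1 h2; rewrite ?h1 ?h2 ?subrr !mulr0..].
  rewrite -!sumrN -big_split/=; apply: eq_bigr => x _; ring.
under eq_bigr do rewrite splitE.
rewrite big_split/= !sumrN.
rewrite (sum_symmetric (fun s => \sum_(x \in [set: G]) (u (x * s)%g - u x) * phi x)).
ring.
Qed.

(** Testing - Delta u against its own truncation, which is bounded by t and
    lives on D. *)
Lemma energy_trunc u (D : {fset G}) t : 0 < t ->
  (forall x, t < `|u x| -> x \in D) ->
  energy S (trunc t \o u) <= 2 * t * \sum_(x <- D) `|laplacian S u x|.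
Proof.
move=> t0 uD; pose phi := trunc t \o u.
have phiD x : phi x != 0 -> x \in D by move/(trunc_neq0 t0)/uD.
apply: (@le_trans _ _ (\sum_(s <- fset_set S)
   \sum_(x \in [set: G]) (u (x * s)%g - u x) * (phi (x * s)%g - phi x))).
  rewrite /energy -/phi; apply: ler_sum => s _.
  rewrite !(sumT_shift_supp (y := s) phiD);
    [|by move=> x h1 h2; rewrite ?h1 ?h2 ?subrr ?mulr0 ?expr0n..].
  by apply: ler_sum => x _; exact: trunc_lip.
rewrite (summation_by_parts u phiD) mulNr -mulrN -mulrA ler_pM2l//.
rewrite (sumT_fset (D := D)); last first.
  by move=> x; rewrite mulf_eq0 negb_or => /andP[_ /phiD].
rewrite -sumrN mulr_sumr; apply: ler_sum => x _.
apply: le_trans (ler_norm _) _.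
by rewrite normrN normrM mulrC ler_wpM2r// trunc_norm_le.
Qed.

End Laplacian.

(** * Masses in l^p, superlevel sets and dyadic sums *)

Section LpSum.
Variables (R : realType) (G : groupType).
Implicit Types (p : R) (u : G -> R) (F : {fset G}).

(** The p-th power of the l^p norm. Limits and splittings are stated for it
    rather than for the norm, since it is additive over disjoint sets. *)
Definition lpmass p u : \bar R := (\esum_(x in [set: G]) (`|u x| `^ p)%:E)%E.
Definition in_lp p u : Prop := (lpmass p u < +oo)%E.
Definition lpsum p u : R := fine (lpmass p u).

Lemma lpmass_ge0 p u : (0 <= lpmass p u)%E.
Proof. by apply: esum_ge0 => x _; rewrite lee_fin powR_ge0. Qed.

Lemma lpsum_ge0 p u : 0 <= lpsum p u.
Proof. by apply: fine_ge0; exact: lpmass_ge0. Qed.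

Lemma lpmassE p u : in_lp p u -> lpmass p u = (lpsum p u)%:E.
Proof. by move=> up; rewrite fineK// ge0_fin_numE// lpmass_ge0. Qed.

Lemma le_lpsum p u F : in_lp p u -> \sum_(x <- F) `|u x| `^ p <= lpsum p u.
Proof.
move=> up; rewrite -lee_fin -lpmassE//; apply: esum_ge.
exists [set` F]; first by split=> //; exact: finite_fset.
by rewrite fsbig_finite// ?set_fsetK ?sumEFin//; exact: finite_fset.
Qed.

(** With [le_lpsum], the way sums over the whole group are handled: they are
    bounded exactly when all finite partial sums are. *)
Lemma lpsum_le p u (W : R) : (forall F, \sum_(x <- F) `|u x| `^ p <= W) ->
  in_lp p u /\ lpsum p u <= W.
Proof.
move=> uW; have lW : (lpmass p u <= W%:E)%E.
  apply: ge_ereal_sup => _ [A [finA _] <-].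
  by rewrite fsbig_finite// sumEFin lee_fin.
have up : in_lp p u by apply: le_lt_trans lW (ltry _).
by split=> //; rewrite -lee_fin -lpmassE.
Qed.

Lemma lpsum_approx p u (e : R) : in_lp p u -> 0 < e ->
  exists F, lpsum p u - e < \sum_(x <- F) `|u x| `^ p.
Proof.
move=> up e0; apply: contrapT => h.
have [_] : in_lp p u /\ lpsum p u <= lpsum p u - e.
  apply: lpsum_le => F; rewrite leNgt; apply/negP => hF; apply: h.
  by exists F.
by apply/negP; rewrite -ltNge gtrBl.
Qed.

Lemma lpterm_le p u x : in_lp p u -> `|u x| `^ p <= lpsum p u.
Proof. by move=> /(le_lpsum [fset x]%fset); rewrite big_seq_fset1. Qed.

Lemma lpnormE p u : in_lp p u -> lpnorm p u = (lpsum p u `^ p^-1)%:E.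
Proof. by move=> up; rewrite /lpnorm -/(lpmass p u) lpmassE. Qed.

Lemma in_lpP p u : 0 < p -> (lpnorm p u < +oo)%E <-> in_lp p u.
Proof.
move=> p0; split; last by move=> up; rewrite lpnormE// ltry.
by rewrite /lpnorm; apply: lty_poweRy; rewrite invr_eq0 gt_eqF.
Qed.

Lemma lpnorm_powE p u : 0 < p -> in_lp p u ->
  (lpnorm p u `^ p)%E = (lpsum p u)%:E.
Proof.
move=> p0 up; rewrite lpnormE// poweR_EFin -powRrM mulVf ?gt_eqF//.
by rewrite powRr1 ?lpsum_ge0.
Qed.

Lemma lpnorm_eq1 p u : 0 < p -> lpnorm p u = 1%E <-> in_lp p u /\ lpsum p u = 1.
Proof.
move=> p0; split=> [u1|[up u1]]; last by rewrite lpnormE// u1 powR1.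
have up : in_lp p u by apply/in_lpP; rewrite // u1 ltry.
split=> //; have := lpnorm_powE p0 up; rewrite u1 poweR1r.
by move=> /(congr1 fine) /= <-.
Qed.

Lemma lpmassN p u : lpmass p (fun x => - u x) = lpmass p u.
Proof. by apply: eq_esum => x _; rewrite normrN. Qed.

Lemma in_lpN p u : in_lp p u -> in_lp p (fun x => - u x).
Proof. by rewrite /in_lp lpmassN. Qed.

Lemma lpsumN p u : lpsum p (fun x => - u x) = lpsum p u.
Proof. by rewrite /lpsum lpmassN. Qed.

Lemma lpmass_translate p u y : lpmass p (fun x => u (y * x)%g) = lpmass p u.
Proof.
rewrite /lpmass [RHS](@reindex_esum _ _ _ setT setT (fun x => (y * x)%g))//.
rewrite setTT_bijective; exists (fun x => (y^-1 * x)%g) => x.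
  exact: mulKg.
exact: mulVKg.
Qed.

Lemma in_lp_translate p u y : in_lp p u -> in_lp p (fun x => u (y * x)%g).
Proof. by rewrite /in_lp lpmass_translate. Qed.

Lemma lpsum_translate p u y : lpsum p (fun x => u (y * x)%g) = lpsum p u.
Proof. by rewrite /lpsum lpmass_translate. Qed.

Definition superlevel u (t : R) : {fset G} := fset_set [set x | t < `|u x|].

Lemma chebyshev p u F t : in_lp p u -> 0 < p -> 0 <= t ->
  (forall x, x \in F -> t <= `|u x|) ->
  #|` F|%:R * t `^ p <= lpsum p u.
Proof.
move=> up p0 t0 uF; apply: le_trans (le_lpsum F up).
rewrite -sum_fset_const big_seq [leRHS]big_seq; apply: ler_sum => x xF.
by rewrite ge0_ler_powR ?nnegrE ?uF// ltW.
Qed.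

(** By Chebyshev's inequality a superlevel set of an l^p function is finite,
    so that [fset_set] does not collapse it to the empty set. *)
Lemma in_superlevel p u t x : in_lp p u -> 0 < p -> 0 < t ->
  (x \in superlevel u t) = (t < `|u x|).
Proof.
move=> up p0 t0; rewrite in_fset_set; first by apply/idP/idP; rewrite inE.
apply: contrapT => /infinite_set_fset.
have tp : 0 < t `^ p by rewrite powR_gt0.
move=> /(_ (Num.truncn (lpsum p u / t `^ p)).+1) [B BA Bn].
have h : #|` B|%:R * t `^ p <= lpsum p u.
  by apply: chebyshev up p0 (ltW t0) _ => y yB; apply/ltW/BA.
have := truncnS_gt (lpsum p u / t `^ p).
rewrite ltNge => /negP; apply.
rewrite ler_pdivlMr//; apply: le_trans h.
by rewrite ler_wpM2r ?ler_nat// ltW.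
Qed.

End LpSum.

Section Dyadic.
Variable R : realType.
Implicit Types a z B : R.

(** The two dyadic sums below are compared with this one, in which min (t, z)
    plays the role of the truncation of z at height t. *)
Lemma dyadic_telescope a z B n : 0 < a -> 0 <= z -> 0 < B ->
  \sum_(j < n) (Num.min (B / 2 ^+ j) z `^ a - Num.min (B / 2 ^+ j.+1) z `^ a)
  = Num.min B z `^ a - Num.min (B / 2 ^+ n) z `^ a.
Proof.
move=> a0 z0 B0.
rewrite -(big_mkord xpredT (fun j => Num.min (B / 2 ^+ j) z `^ a - Num.min (B / 2 ^+ j.+1) z `^ a)).
elim: n => [|n ih]; first by rewrite big_nil expr0 divr1 subrr.
by rewrite big_nat_recr//= ih; ring.
Qed.

Lemma half_powR_lt1 a : 0 < a -> 2^-1 `^ a < 1 :> R.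
Proof.
move=> a0; have : 2^-1 `^ a < 1 `^ a :> R; last by rewrite powR1.
by apply: gt0_ltr_powR; rewrite ?nnegrE//; lra.
Qed.

(** A geometric sum dominated by its largest term, which is less than z^a. *)
Lemma dyadic_sum_le a z B n : 0 < a -> 0 <= z -> 0 < B ->
  \sum_(j < n) (if B / 2 ^+ j < z then (B / 2 ^+ j) `^ a else 0)
  <= z `^ a / (1 - 2^-1 `^ a).
Proof.
move=> a0 z0 B0.
have k0 : 0 < 1 - 2^-1 `^ a :> R by rewrite subr_gt0 half_powR_lt1.
rewrite ler_pdivlMr// mulr_suml.
apply: (@le_trans _ _ (\sum_(j < n)
  (Num.min (B / 2 ^+ j) z `^ a - Num.min (B / 2 ^+ j.+1) z `^ a))).
  apply: ler_sum => j _; rewrite exprSr invfM mulrA.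
  have t0 : 0 < B / 2 ^+ j by rewrite divr_gt0// exprn_gt0.
  set t := B / 2 ^+ j in t0 *.
  have t20 : 0 <= t / 2 by lra.
  case: ltP => [tz|zt].
    rewrite min_l; last by lra.
    by rewrite powRM ?invr_ge0 ?(ltW t0)// mulrBr mulr1 lexx.
  rewrite mul0r subr_ge0 ge0_ler_powR ?nnegrE ?le_min ?ge_min ?t20 ?z0 ?lexx ?orbT//.
  exact: ltW.
rewrite dyadic_telescope//.
have : 0 <= Num.min (B / 2 ^+ n) z `^ a by exact: powR_ge0.
have : Num.min B z `^ a <= z `^ a.
  by rewrite ge0_ler_powR ?nnegrE ?le_min ?ge_min ?(ltW a0) ?(ltW B0) ?z0 ?lexx ?orbT.
lra.
Qed.

(** Some dyadic height lies just below z, unless z is smaller than all of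
    them; the subtracted term is the error due to stopping after n heights. *)
Lemma dyadic_sum_ge a z B n : 0 < a -> 0 <= z <= B -> 0 < B ->
  z `^ a - (B / 2 ^+ n) `^ a <=
  \sum_(j < n) (if B / 2 ^+ j.+1 < z then (B / 2 ^+ j) `^ a else 0).
Proof.
move=> a0 /andP[z0 zB] B0.
apply: (@le_trans _ _ (\sum_(j < n)
  (Num.min (B / 2 ^+ j) z `^ a - Num.min (B / 2 ^+ j.+1) z `^ a))).
  rewrite dyadic_telescope// min_r// lerD2l lerN2.
  have : 0 < B / 2 ^+ n by rewrite divr_gt0// exprn_gt0.
  move=> t0; rewrite ge0_ler_powR ?nnegrE ?le_min ?ge_min ?lexx ?z0 ?(ltW t0) ?(ltW a0)//.
apply: ler_sum => j _; rewrite exprSr invfM mulrA.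
have t0 : 0 < B / 2 ^+ j by rewrite divr_gt0// exprn_gt0.
set t := B / 2 ^+ j in t0 *.
case: ltP => [tz|zt].
  apply: (@le_trans _ _ (Num.min t z `^ a)); first by rewrite gerBl powR_ge0.
  by rewrite ge0_ler_powR ?nnegrE ?le_min ?ge_min ?lexx ?z0 ?(ltW t0) ?(ltW a0).
by rewrite !min_r ?subrr//; lra.
Qed.

End Dyadic.

(** * The second-order Sobolev inequality *)

(** The radius of a ball of polynomial volume that has twice as many points as
    a set of n points is of order n^(1/N). *)
Lemma radius_choice (R : realType) (N : nat) (C1 : R) : (0 < N)%N -> 0 < C1 ->
  exists2 C0 : R, 0 < C0 & forall n : nat, (0 < n)%N -> exists r : nat,
    [/\ (0 < r)%N, 2 * n%:R <= C1 * r%:R ^+ N & r%:R ^+ 2 <= C0 * n%:R `^ (2 / N%:R)].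
Proof.
move=> N0 C10; have N0' : 0 < N%:R :> R by rewrite ltr0n.
pose c := (2 / C1) `^ N%:R^-1.
have c0 : 0 < c by rewrite powR_gt0// divr_gt0.
exists ((c + 1) ^+ 2) => [|n n0]; first by rewrite exprn_gt0// addr_gt0.
have n1 : 1 <= n%:R :> R by rewrite ler1n.
have n0' : 0 < n%:R :> R by rewrite ltr0n.
pose rho := c * n%:R `^ N%:R^-1.
have rho0 : 0 <= rho by rewrite mulr_ge0 ?powR_ge0// ltW.
have rhoN : rho ^+ N = 2 * n%:R / C1.
  rewrite -powR_mulrn// /rho powRM ?powR_ge0 ?(ltW c0)//.
  rewrite -!powRrM mulVf ?gt_eqF// !powRr1 ?divr_ge0 ?(ltW n0') ?(ltW C10)//.
  by rewrite mulrAC.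
have ltr := truncnS_gt rho.
exists (Num.truncn rho).+1; split=> //.
  rewrite [leRHS]mulrC -ler_pdivrMr// -rhoN lerXn2r ?nnegrE ?ler0n//.
  exact: ltW.
have : (Num.truncn rho).+1%:R <= (c + 1) * n%:R `^ N%:R^-1 :> R.
  rewrite -natr1 mulrDl mul1r lerD//.
    by have /andP[] := truncn_itv rho0.
  rewrite -[leLHS](powRr0 n%:R) ler_powR// invr_ge0 ltW//.
move=> /(fun h => lerXn2r 2 _ _ h).
rewrite !nnegrE mulr_ge0 ?powR_ge0 ?addr_ge0 ?(ltW c0)// => /(_ (ler0n _ _) isT).
rewrite exprMn => /le_trans; apply; rewrite ler_wpM2l ?sqr_ge0//.
by rewrite -powR_mulrn ?powR_ge0// -powRrM mulrC.
Qed.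

Lemma dyadic_scale_small (R : realType) (a B e : R) : 0 < a -> 0 < B -> 0 < e ->
  exists n, (B / 2 ^+ n) `^ a < e.
Proof.
move=> a0 B0 e0; pose d := e `^ a^-1.
have d0 : 0 < d by rewrite powR_gt0.
exists (Num.truncn (B / d)).+1.
set n := (Num.truncn _).+1.
have -> : e = d `^ a by rewrite -powRrM mulVf ?gt_eqF// powRr1// ltW.
have n20 : 0 < 2 ^+ n :> R by rewrite exprn_gt0.
apply: gt0_ltr_powR => //; rewrite ?nnegrE ?divr_ge0 ?ltW//.
rewrite ltr_pdivrMr// mulrC -ltr_pdivrMr//.
apply: lt_trans (truncnS_gt _) _.
by rewrite -natrX ltr_nat ltn_expl.
Qed.

(** Young's inequality for the exponents p and p/(p-1), without sharp constants:
    one of the two summands on the right dominates, according to whether g is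
    at most tau z^(sigma/p) or not. *)
Lemma young_split (R : realType) (p sigma tau g z : R) : 1 < p -> 0 < sigma -> 0 < tau ->
  0 <= g -> 0 <= z ->
  g * z `^ (sigma * (1 - p^-1)) <= tau * z `^ sigma + tau `^ (1 - p) * g `^ p.
Proof.
move=> p1 s0 tau0 g0 z0; have p0 : 0 < p by lra.
have a0 : 0 <= sigma * (1 - p^-1).
  by rewrite mulr_ge0 ?ltW// subr_gt0 invf_lt1.
have [gz|zg] := leP g (tau * z `^ (sigma / p)).
  apply: (@le_trans _ _ (tau * z `^ sigma)); last first.
    by rewrite lerDl mulr_ge0// powR_ge0.
  apply: le_trans (ler_wpM2r (powR_ge0 _ _) gz) _.
  rewrite -mulrA -powRD; last first.
    by apply/implyP => /eqP h; exfalso; move: h; nra.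
  by rewrite ler_wpM2l ?(ltW tau0)// le_eqVlt; apply/orP; left; apply/eqP;
    congr (_ `^ _); field; rewrite gt_eqF.
apply: (@le_trans _ _ (tau `^ (1 - p) * g `^ p)); last first.
  by rewrite lerDr mulr_ge0 ?powR_ge0// ltW.
have -> : sigma * (1 - p^-1) = (sigma / p) * (p - 1) by field; rewrite gt_eqF.
rewrite powRrM; have gp : z `^ (sigma / p) <= g / tau.
  by rewrite ler_pdivlMr// mulrC ltW.
have gt0 : 0 <= g / tau by rewrite divr_ge0// ltW.
have : z `^ (sigma / p) `^ (p - 1) <= (g / tau) `^ (p - 1).
  by rewrite ge0_ler_powR ?nnegrE ?powR_ge0//; lra.
move/(ler_wpM2l g0) => /le_trans; apply.
rewrite powRM ?invr_ge0 ?(ltW tau0)// mulrA mulr_powRB1//.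
rewrite -powR_inv1 ?(ltW tau0)// -powRrM.
by rewrite mulN1r opprB mulrC.
Qed.

Section Sobolev.
Variables (R : realType) (G : groupType) (S : set G) (N : nat).
Hypotheses (finS : finite_set S) (symS : symmetric_set S).
Hypotheses (growthS : polynomial_growth R S N) (N0 : (0 < N)%N).
Implicit Types (u : G -> R).

(** [capacity_bound] for u truncated between t and 2t, in a ball of radius
    about #{|u| > t}^(1/N), with the energy estimated by [energy_trunc]. *)
Lemma level_inequality : exists2 C : R, 0 < C &
  forall sigma u t, 0 < sigma -> in_lp sigma u -> 0 < t ->
  t * #|` superlevel u (2 * t)|%:R <=
  C * #|` superlevel u t|%:R `^ (2 / N%:R) *
  \sum_(x <- superlevel u t) `|laplacian S u x|.
Proof.
have [C1 [C2 [C10 _ growthC]]] := growthS.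
have [C0 C00 radius] := radius_choice N0 C10.
exists (4 * C0) => [|sigma u t s0 us t0]; first by rewrite mulr_gt0.
set D := superlevel u t; set D2 := superlevel u (2 * t).
have memD x : (x \in D) = (t < `|u x|) by rewrite (in_superlevel _ us).
have memD2 x : (x \in D2) = (2 * t < `|u x|).
  by rewrite (in_superlevel _ us)// mulr_gt0.
have sum0 : 0 <= \sum_(x <- D) `|laplacian S u x| by exact: sumr_ge0.
have [D0|Dpos] := posnP #|` D|.
  suff -> : D2 = fset0.
    by rewrite cardfs0 mulr0 !mulr_ge0 ?powR_ge0// ltW.
  apply/eqP; rewrite -fsubset0 -(cardfs0_eq D0); apply/fsubsetP => x.
  by rewrite memD memD2; lra.
have [r [r0 rn r2]] := radius _ Dpos.
have /growthC/andP[gr _] := r0.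
have g2 : (2 * #|` D| <= growth S r)%N.
  by rewrite -(ler_nat R) natrM (le_trans rn).
have g0 : (0 < growth S r)%N by apply: leq_trans g2; rewrite muln_gt0.
have phiD x : (trunc t \o u) x != 0 -> x \in D.
  by move/(trunc_neq0 t0); rewrite memD.
have D2t x : x \in D2 -> t <= `|(trunc t \o u) x|.
  by rewrite memD2; exact: trunc_norm_ge.
have cap := capacity_bound finS g0 phiD g2 (ltW t0) D2t.
have uD x : t < `|u x| -> x \in D by rewrite memD.
have en := energy_trunc finS symS t0 uD.
rewrite -(ler_pM2l t0).
apply: (@le_trans _ _ (2 * r%:R ^+ 2 * (2 * t * \sum_(x <- D) `|laplacian S u x|))).
  rewrite [leLHS]mulrA -expr2 [leLHS]mulrC; apply: le_trans cap _.
  by rewrite ler_wpM2l// mulr_ge0// sqr_ge0.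
set I := \sum_(x <- D) _ in sum0 *.
have -> : 2 * r%:R ^+ 2 * (2 * t * I) = r%:R ^+ 2 * (4 * t * I) by ring.
set m := #|` D|%:R `^ _ in r2 *.
have -> : t * (4 * C0 * m * I) = C0 * m * (4 * t * I) by ring.
by rewrite ler_wpM2r// !mulr_ge0// ltW.
Qed.

(** [level_inequality] times t^(sigma-1), after Chebyshev's inequality on the
    factor n(t)^(2/N). The exponent a is chosen so that the powers of t match;
    for the critical exponent it equals sigma (1 - 1/p). *)
Lemma weighted_level_inequality (sigma a : R) : 0 < sigma ->
  a = sigma * (1 - 2 / N%:R) - 1 ->
  exists2 C : R, 0 < C & forall u t, in_lp sigma u -> 0 < t ->
  t `^ sigma * #|` superlevel u (2 * t)|%:R <=
  C * lpsum sigma u `^ (2 / N%:R) * (t `^ a *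
  \sum_(x <- superlevel u t) `|laplacian S u x|).
Proof.
move=> s0 aE; have [C C0 level] := level_inequality.
exists C => // u t us t0.
have N0' : 0 < N%:R :> R by rewrite ltr0n.
have n20 : 0 <= 2 / N%:R :> R by rewrite divr_ge0.
set D := superlevel u t; set W := lpsum sigma u.
have cheb : #|` D|%:R * t `^ sigma <= W.
  by apply: chebyshev => //; [exact: ltW|move=> x; rewrite (in_superlevel _ us)// => /ltW].
have {}cheb : #|` D|%:R `^ (2 / N%:R) <= W `^ (2 / N%:R) * t `^ (- (sigma * (2 / N%:R))).
  rewrite powRN ler_pdivlMr ?powR_gt0//.
  rewrite powRrM -powRM ?powR_ge0//.
  by rewrite ge0_ler_powR ?nnegrE ?mulr_ge0 ?powR_ge0 ?lpsum_ge0.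
have := level _ _ _ s0 us t0; rewrite -/D => lev.
have -> : t `^ sigma = t `^ (sigma - 1) * t.
  by rewrite mulrC mulr_powRB1// ltW.
rewrite -mulrA; apply: le_trans (ler_wpM2l (powR_ge0 _ _) lev) _.
set I := \sum_(x <- D) _; have I0 : 0 <= I by exact: sumr_ge0.
have -> : t `^ a = t `^ (sigma - 1) * t `^ (- (sigma * (2 / N%:R))).
  rewrite -powRD; last by rewrite (gt_eqF t0) implybT.
  by congr (_ `^ _); rewrite aE; ring.
set p1 := t `^ (sigma - 1).
rewrite [leLHS](_ : _ = C * p1 * #|` D|%:R `^ (2 / N%:R) * I); last by ring.
rewrite [leRHS](_ : _ = C * p1 * (W `^ (2 / N%:R) *
  t `^ (- (sigma * (2 / N%:R)))) * I); last by ring.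
by rewrite ler_wpM2r// ler_wpM2l// mulr_ge0 ?powR_ge0// ltW.
Qed.

(** Sum [weighted_level_inequality] over the dyadic heights below the supremum
    of |u|.  On the left the sum reconstitutes the l^sigma mass; on the right,
    exchanging the sums leaves |Delta u| |u|^a, where [young_split] applies.
    The assumption on sigma is the relation 1/sigma = 1/p - 2/N. *)
Lemma dyadic_estimate (p sigma : R) : 1 < p -> 0 < sigma ->
  sigma * (1 - 2 / N%:R) - 1 = sigma * (1 - p^-1) ->
  exists2 K : R, 0 < K & forall u (tau : R), in_lp sigma u ->
    in_lp p (laplacian S u) -> 0 < lpsum sigma u -> 0 < tau ->
    lpsum sigma u <= K * lpsum sigma u `^ (2 / N%:R) *
      (tau * lpsum sigma u + tau `^ (1 - p) * lpsum p (laplacian S u)).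
Proof.
move=> p1 s0 aE; set a := sigma * (1 - p^-1) in aE.
have p0 : 0 < p by lra.
have a0 : 0 < a by rewrite mulr_gt0// subr_gt0 invf_lt1.
have [C C0 level] := weighted_level_inequality s0 (esym aE).
have k0 : 0 < 1 - 2^-1 `^ a :> R by rewrite subr_gt0 half_powR_lt1.
exists (4 `^ sigma * C / (1 - 2^-1 `^ a)) => [|u tau us lup W0 tau0].
  by rewrite divr_gt0// mulr_gt0// powR_gt0.
set W := lpsum sigma u in W0 *; set P := lpsum p (laplacian S u).
set rhs := leRHS.
(* W^(1/sigma) bounds |u|, so the superlevel set at height B is empty. *)
pose B := W `^ sigma^-1; have B0 : 0 < B by rewrite powR_gt0.
have uB x : `|u x| <= B.
  have -> : `|u x| = (`|u x| `^ sigma) `^ sigma^-1.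
    by rewrite -powRrM mulfV ?gt_eqF// powRr1.
  rewrite ge0_ler_powR ?nnegrE ?powR_ge0 ?lpsum_ge0 ?lpterm_le//.
  by rewrite invr_ge0 ltW.
have main (F : {fset G}) n : \sum_(x <- F) `|u x| `^ sigma -
    #|` F|%:R * (B / 2 ^+ n) `^ sigma <= rhs.
  (* The factor 4: the level s_(j+1) = 2 t_j, at which points are counted, is
     twice the level t_j over which the Laplacian is summed, while the weight
     is s_j. *)
  pose s j := B / 2 ^+ j; pose t j := B / 4 / 2 ^+ j.
  have t0 j : 0 < t j by rewrite !divr_gt0// exprn_gt0.
  have ts j : 2 * t j = s j.+1.
    rewrite /s /t exprS; field; rewrite expf_neq0//; lra.
  have st j : s j `^ sigma = 4 `^ sigma * t j `^ sigma.
    rewrite -powRM ?ltW//; congr (_ `^ _); rewrite /s /t; field.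
    by rewrite expf_neq0//; lra.
  apply: (@le_trans _ _ (\sum_(j < n) s j `^ sigma * #|` superlevel u (s j.+1)|%:R)).
    rewrite -sum_fset_const -sumrB.
    apply: (@le_trans _ _ (\sum_(x <- F) \sum_(j < n)
        (if s j.+1 < `|u x| then s j `^ sigma else 0))).
      by apply: ler_sum => x _; apply: dyadic_sum_ge => //; rewrite normr_ge0 uB.
    rewrite exchange_big/=; apply: ler_sum => j _.
    rewrite mulrC -sum_fset_const -big_mkcond/=.
    rewrite big_fset_condE.
    apply: sum_fset_sub => [|x]; last exact: powR_ge0.
    apply/fsubsetP => x; rewrite !inE/= (in_superlevel _ us)//; last first.
      by rewrite -ts mulr_gt0.
    by case/andP.
  apply: (@le_trans _ _ (4 `^ sigma * (C * W `^ (2 / N%:R) *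
      \sum_(j < n) t j `^ a * \sum_(x <- superlevel u (t j)) `|laplacian S u x|))).
    rewrite !mulr_sumr; apply: ler_sum => j _.
    by rewrite st -mulrA ler_wpM2l ?powR_ge0// -ts; apply: level.
  have inner : \sum_(j < n) t j `^ a * \sum_(x <- superlevel u (t j)) `|laplacian S u x|
      <= (tau * W + tau `^ (1 - p) * P) / (1 - 2^-1 `^ a).
    pose D := superlevel u (t n).
    apply: (@le_trans _ _ (\sum_(x <- D) `|laplacian S u x| *
        \sum_(j < n) (if t j < `|u x| then t j `^ a else 0))).
      under [leRHS]eq_bigr do rewrite mulr_sumr.
      rewrite [leRHS]exchange_big/=; apply: ler_sum => j _.
      rewrite mulr_sumr.
      rewrite [leRHS](eq_bigr (fun x =>
        if t j < `|u x| then t j `^ a * `|laplacian S u x| else 0)); last first.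
        by move=> x _; case: ifP; rewrite ?mulr0// mulrC.
      rewrite -[leRHS]big_mkcond/= [leRHS]big_fset_condE.
      apply: sum_fset_sub => [|x]; last by rewrite mulr_ge0 ?powR_ge0.
      apply/fsubsetP => x; rewrite !inE/= !(in_superlevel _ us)// => tx.
      rewrite tx andbT; apply: le_lt_trans tx.
      rewrite /t ler_pM2l ?divr_gt0// lef_pV2 ?posrE ?exprn_gt0//.
      by apply: ler_weXn2l; [rewrite ler1n|exact/ltnW/ltn_ord].
    apply: (@le_trans _ _ (\sum_(x <- D) ((tau * `|u x| `^ sigma +
        tau `^ (1 - p) * `|laplacian S u x| `^ p) / (1 - 2^-1 `^ a)))).
      apply: ler_sum => x _.
      have B40 : 0 < B / 4 by rewrite divr_gt0.
      have := dyadic_sum_le n a0 (normr_ge0 (u x)) B40.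
      move/(ler_wpM2l (normr_ge0 (laplacian S u x))) => /le_trans; apply.
      by rewrite mulrA ler_wpM2r ?invr_ge0 ?(ltW k0)// young_split.
    rewrite -mulr_suml ler_wpM2r ?invr_ge0 ?(ltW k0)//.
    rewrite big_split/= -!mulr_sumr.
    by apply: lerD; rewrite ler_wpM2l ?powR_ge0 ?(ltW tau0)//; exact: le_lpsum.
  rewrite /rhs.
  rewrite [leRHS](_ : _ = 4 `^ sigma * (C * W `^ (2 / N%:R) *
    ((tau * W + tau `^ (1 - p) * P) / (1 - 2^-1 `^ a)))); last by ring.
  by rewrite ler_wpM2l ?powR_ge0// ler_wpM2l// mulr_ge0 ?powR_ge0// ltW.
have [] // : in_lp sigma u /\ W <= rhs.
apply: lpsum_le => F; apply/ler_addgt0Pr => e e0.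
have F0 : 0 < #|` F|%:R + 1 :> R by rewrite ltr_wpDl.
have [n /ltW] := dyadic_scale_small s0 B0 (divr_gt0 e0 F0).
rewrite ler_pdivlMr// => ne.
have := main F n; rewrite lerBlDr => /le_trans; apply.
rewrite lerD2l; apply: le_trans ne.
by rewrite mulrC ler_wpM2l ?powR_ge0// lerDl.
Qed.

(** In [dyadic_estimate] the mass W occurs on both sides; for tau of order
    W^(-2/N) half of it is absorbed, as W is finite.  What remains reads
    W <= C W^(2p/N) |Delta u|_p^p, and 1 - 2p/N = p/sigma. *)
Theorem sobolev_inequality (p : R) : 1 < p -> p < N%:R / 2 ->
  exists2 C : R, 0 < C & forall u, in_lp (critical_exponent N p) u ->
    in_lp p (laplacian S u) ->
    lpsum (critical_exponent N p) u `^ (p / critical_exponent N p)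
      <= C * lpsum p (laplacian S u).
Proof.
move=> p1 pN; set sigma := critical_exponent N p.
have p0 : 0 < p by lra.
have N0' : 0 < N%:R :> R by rewrite ltr0n.
have d0 : 0 < N%:R - 2 * p by lra.
have s0 : 0 < sigma by rewrite divr_gt0// mulr_gt0.
have sE : sigma * (1 - 2 / N%:R) - 1 = sigma * (1 - p^-1).
  rewrite /sigma /critical_exponent; field.
  by rewrite !gt_eqF.
have [K K0 est] := dyadic_estimate p1 s0 sE.
exists ((2 * K) `^ p) => [|u us lup]; first by rewrite powR_gt0// mulr_gt0.
set W := lpsum sigma u; set P := lpsum p _.
have P0 : 0 <= P by exact: lpsum_ge0.
have : 0 <= W by exact: lpsum_ge0.
rewrite le_eqVlt => /predU1P[<-|W0].
  by rewrite powR0 ?mulr_ge0 ?powR_ge0// mulf_neq0 ?invr_neq0 ?gt_eqF.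
set M := 2 * K * W `^ (2 / N%:R).
have M0 : 0 < M by rewrite !mulr_gt0// powR_gt0.
have := est u M^-1 us lup W0; rewrite invr_gt0 => /(_ M0).
rewrite -/W -/P => h.
have {}h : W <= M `^ p * P.
  have -> : M `^ p = M * M^-1 `^ (1 - p).
    rewrite -powR_inv1 ?(ltW M0)// -powRrM mulN1r opprB mulr_powRB1//.
    exact: ltW.
  have : K * W `^ (2 / N%:R) * (M^-1 * W) = W / 2.
    rewrite /M; field; rewrite !gt_eqF ?powR_gt0//.
  move: h; rewrite mulrDr => h e; rewrite e in h.
  have {}h : W / 2 <= K * W `^ (2 / N%:R) * (M^-1 `^ (1 - p) * P) by lra.
  move: h; rewrite ler_pdivrMr// => /le_trans; apply.
  by rewrite le_eqVlt; apply/orP; left; apply/eqP; rewrite [in LHS]/M /M; ring.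
have -> : p / sigma = 1 - 2 * p / N%:R.
  by rewrite /sigma /critical_exponent; field; rewrite !gt_eqF.
rewrite powRB; last by rewrite (gt_eqF W0) implybT.
rewrite powRr1 ?(ltW W0)// ler_pdivrMr ?powR_gt0//.
apply: le_trans h _; rewrite /M powRM ?mulr_ge0 ?powR_ge0 ?(ltW K0)//.
rewrite -powRrM le_eqVlt; apply/orP; left; apply/eqP.
by rewrite (_ : 2 / N%:R * p = 2 * p / N%:R) 1?mulrAC.
Qed.
End Sobolev.

(** * Limits along a filter and the Brezis-Lieb lemma *)

Section Limits.
Variable R : realType.

Lemma cvg_powR (T : Type) (F : set_system T) (FF : ProperFilter F) (f : T -> R)
  (l p : R) : 0 < p -> (forall x, 0 <= f x) -> f @ F --> l ->
  (fun x => f x `^ p) @ F --> l `^ p.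
Proof.
move=> p0 f0 fl.
have : 0 <= l by apply: (cvgr_to_ge fl); apply: nearW.
rewrite le_eqVlt => /predU1P[l0|l0].
  rewrite -l0 in fl *; rewrite powR0 ?gt_eqF//.
  apply/cvgr0Pnorm_lt => e e0.
  have d0 : 0 < e `^ p^-1 by rewrite powR_gt0.
  move/cvgr0Pnorm_lt: fl => /(_ _ d0); apply: filterS => x.
  rewrite !ger0_norm ?powR_ge0// => fx.
  have -> : e = (e `^ p^-1) `^ p by rewrite -powRrM mulVf ?gt_eqF// powRr1// ltW.
  by apply: gt0_ltr_powR; rewrite ?nnegrE ?f0 ?(ltW d0).
apply: (@continuous_cvg _ _ _ _ FF f (fun x => x `^ p) l) => //.
apply: differentiable_continuous; apply/derivable1_diffP.
by apply: derivable_powR; rewrite in_itv/= l0.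
Qed.

(** A cluster point exists by compactness, and an ultrafilter converges to any
    of its cluster points. *)
Lemma bounded_ultra_cvg (T : Type) (U : set_system T) (f : T -> R) (M : R) :
  UltraFilter U -> U [set n | `|f n| <= M] -> exists l : R, f @ U --> l.
Proof.
move=> UU fM.
have fU : U (f @^-1` `[- M, M]%classic).
  by apply: filterS fM => n /=; rewrite in_itv/= ler_norml.
have [l [_ cl]] := @segment_compact R (- M) M _ (fmap_proper_filter f _) fU.
exists l => V Vl.
have [//|UV] := in_ultra_setVsetC (f @^-1` V) UU.
by have [y []] := cl (~` V) V UV Vl.
Qed.

(** The sets of indices where |h| is small belong to U, and so do all tails,
    so they meet: indices can be chosen one after the other. *)
Lemma extract_subsequence (U : set_system nat) (h : nat -> R) :
  ProperFilter U -> \oo `<=` U -> h @ U --> 0 ->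
  exists2 phi : nat -> nat, {homo phi : m n / (m < n)%N} &
    (h \o phi) @ \oo --> 0.
Proof.
move=> UU ooU hU.
have step (km : nat * nat) : exists n, (km.2 < n)%N /\ `|h n| < km.1.+1%:R^-1.
  have e0 : 0 < km.1.+1%:R^-1 :> R by rewrite invr_gt0.
  move/cvgr0Pnorm_lt: hU => /(_ _ e0) hk.
  have Uk : U [set n | (km.2 < n)%N].
    by apply: ooU; exact: nbhs_infty_gt.
  have [n [n1 n2]] := filter_ex (filterI Uk hk).
  by exists n.
have [nxt nxtP] := choice step.
pose phi := fix phi k := if k is k'.+1 then nxt (k, phi k') else nxt (0%N, 0%N).
have phih k : `|h (phi k)| < k.+1%:R^-1 
  by case: k => [|k]; [case: (nxtP (0%N, 0%N))|case: (nxtP (k.+1, phi k))].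
have phiS k : (phi k < phi k.+1)%N by case: (nxtP (k.+1, phi k)).
exists phi; first exact: (homo_ltn ltn_trans phiS).
apply/cvgr0Pnorm_lt => e e0.
have := near_infty_natSinv_lt (PosNum e0); apply: filterS => n /=.
exact: lt_trans (phih n).
Qed.

End Limits.

(** With d = rho^(1/p) - 1: if |b| <= d |a| then |a + b| <= (1 + d) |a|, and
    otherwise |a + b| <= (1 + 1/d) |b|. *)
Lemma powR_normD_le (R : realType) (p rho : R) : 0 < p -> 1 < rho ->
  exists2 C : R, 0 < C & forall a b : R,
    `|a + b| `^ p <= rho * `|a| `^ p + C * `|b| `^ p.
Proof.
move=> p0 rho1; pose d := rho `^ p^-1 - 1.
have dE : rho = (1 + d) `^ p.
  by rewrite /d addrC subrK -powRrM mulVf ?gt_eqF// powRr1//; lra.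
have d0 : 0 < d.
  rewrite subr_gt0; have : 1 `^ p^-1 < rho `^ p^-1; last by rewrite powR1.
  by apply: gt0_ltr_powR => //; rewrite ?nnegrE ?invr_gt0//; lra.
have d10 : 0 < d^-1 by rewrite invr_gt0.
exists ((1 + d^-1) `^ p) => [|a b]; first by rewrite powR_gt0//; lra.
rewrite {1}dE -!powRM ?normr_ge0; [|lra..].
have ab := ler_normD a b.
have [ba|ab'] := leP `|b| (d * `|a|).
  rewrite -[leLHS]addr0 lerD ?powR_ge0// ge0_ler_powR ?nnegrE ?(ltW p0)//.
    by rewrite mulr_ge0//; lra.
  by rewrite mulrDl mul1r; lra.
rewrite -[leLHS]add0r lerD ?powR_ge0// ge0_ler_powR ?nnegrE ?(ltW p0)//.
  by rewrite mulr_ge0//; lra.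
have : `|a| <= d^-1 * `|b| by rewrite mulrC ler_pdivlMr// mulrC ltW.
by rewrite mulrDl mul1r; lra.
Qed.

Section LpConvergence.
Variables (R : realType) (G : groupType).
Implicit Types (p : R) (f g h : G -> R) (F : {fset G}).

(** The pointwise inequality summed over the complement of F. *)
Lemma tail_normD_le p rho C f g h F : 0 < C -> 0 < rho ->
  (forall a b : R, `|a + b| `^ p <= rho * `|a| `^ p + C * `|b| `^ p) ->
  (forall x, h x = f x + g x) -> in_lp p f -> in_lp p g ->
  in_lp p h /\
  lpsum p h - \sum_(x <- F) `|h x| `^ p <=
    rho * (lpsum p f - \sum_(x <- F) `|f x| `^ p) +
    C * (lpsum p g - \sum_(x <- F) `|g x| `^ p).
Proof.
move=> C0 rho0 ineq hE fp gp.
rewrite lerBlDl; apply: lpsum_le => F'; set rhs := _ + C * _.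
pose D := (F' `|` F)%fset.
have FD : (F `<=` D)%fset by exact: fsubsetUr.
have splitE k : \sum_(x <- D) `|k x| `^ p =
    \sum_(x <- F) `|k x| `^ p + \sum_(x <- (D `\` F)%fset) `|k x| `^ p.
  rewrite (big_fsetID _ (mem F) D)/=; congr (_ + _); apply: eq_fbigl => x.
    by rewrite !inE/= andb_idl// => xF; rewrite xF orbT.
  by rewrite !inE/= andbC.
apply: (@le_trans _ _ (\sum_(x <- D) `|h x| `^ p)).
  by apply: sum_fset_sub => [|x]; [exact: fsubsetUl|exact: powR_ge0].
rewrite splitE lerD2l.
have fD := le_lpsum D fp; have gD := le_lpsum D gp.
rewrite splitE in fD; rewrite splitE in gD.
apply: (@le_trans _ _ (\sum_(x <- (D `\` F)%fset)
   (rho * `|f x| `^ p + C * `|g x| `^ p))).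
  by apply: ler_sum => x _; rewrite hE.
rewrite big_split/= -!mulr_sumr /rhs.
by apply: lerD; rewrite ler_pM2l//; lra.
Qed.

Lemma lpsumB_le p : 0 < p -> exists2 C, 0 < C & forall f g,
  in_lp p f -> in_lp p g ->
  in_lp p (fun x => f x - g x) /\
  lpsum p (fun x => f x - g x) <= 2 * lpsum p f + C * lpsum p g.
Proof.
move=> p0; have [C C0 ineq] := powR_normD_le p0 (ltr1n R 2 : is_true (1 < 2)).
exists C => // f g fp gp.
have [] := @tail_normD_le p 2 C f (fun x => - g x) (fun x => f x - g x) fset0
  C0 (ltr0n R 2) ineq (fun=> erefl) fp (in_lpN gp).
by rewrite !big_seq_fset0 !subr0 lpsumN.
Qed.

Lemma in_lpB p f g : 0 < p -> in_lp p f -> in_lp p g ->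
  in_lp p (fun x => f x - g x).
Proof. by move=> /lpsumB_le[C _ h] fp gp; have [] := h f g fp gp. Qed.

End LpConvergence.

Section BrezisLieb.
Variables (R : realType) (G : groupType) (T : Type) (U : set_system T).
Context {UU : ProperFilter U}.
Implicit Types (p : R) (f g h : G -> R) (F : {fset G}).

Lemma le_cvg (f g : T -> R) (l l' : R) : f @ U --> l -> g @ U --> l' ->
  (forall n, f n <= g n) -> l <= l'.
Proof.
move=> fl gl fg; rewrite -subr_ge0; apply: (cvgr_to_ge (cvgB gl fl)).
by apply: nearW => n; rewrite /= subr_ge0.
Qed.

Lemma cvg_seq_sum (s : seq G) (a : T -> G -> R) (b : G -> R) :
  (forall x, a ^~ x @ U --> b x) ->
  (fun n => \sum_(x <- s) a n x) @ U --> \sum_(x <- s) b x.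
Proof.
move=> ab; elim: s => [|x s IH].
  by under eq_fun do rewrite big_nil; rewrite big_nil; exact: cvg_cst.
under eq_fun do rewrite big_cons; rewrite big_cons.
exact: cvgD.
Qed.

Lemma cvg_lp_partial p (f_ : T -> G -> R) f F : 0 < p ->
  (forall x, f_ ^~ x @ U --> f x) ->
  (fun n => \sum_(x <- F) `|f_ n x| `^ p) @ U --> \sum_(x <- F) `|f x| `^ p.
Proof.
move=> p0 ff; apply: (@cvg_seq_sum _ (fun n x => `|f_ n x| `^ p)) => x.
by apply: cvg_powR => //; apply: cvg_norm; exact: ff.
Qed.

Arguments cvg_lp_partial {p f_ f} F.

(** Fatou's lemma along a filter: finite partial sums pass to the limit. *)
Lemma lpsum_fatou p (f_ : T -> G -> R) f (M : R) : 0 < p ->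
  (forall x, f_ ^~ x @ U --> f x) ->
  U [set n | in_lp p (f_ n) /\ lpsum p (f_ n) <= M] ->
  in_lp p f /\ lpsum p f <= M.
Proof.
move=> p0 ff fM; apply: lpsum_le => F.
apply: (cvgr_to_le (cvg_lp_partial F p0 ff)).
apply: filterS fM => n [fp]; apply: le_trans; exact: le_lpsum.
Qed.

Lemma le_of_le_mul (a b : R) : 0 <= b ->
  (forall rho, 1 < rho -> a <= rho * b) -> a <= b.
Proof.
move=> b0 h; apply/ler_addgt0Pr => e e0.
have b1 : 0 < b + 1 by lra.
have := h (1 + e / (b + 1)); rewrite ltrDl divr_gt0// => /(_ isT) /le_trans; apply.
rewrite mulrDl mul1r lerD2l mulrAC ler_pdivrMr// ler_pM2l//; lra.
Qed.

(** Outside a large finite set f has little mass, so there f_n and f_n - f have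
    nearly the same mass by [tail_normD_le] with rho close to 1, used in both
    directions.  On the finite set f_n tends to f and f_n - f tends to 0. *)
Lemma brezis_lieb p (f_ : T -> G -> R) f (L B : R) : 0 < p ->
  (forall x, f_ ^~ x @ U --> f x) ->
  (forall n, in_lp p (f_ n)) -> in_lp p f ->
  (fun n => lpsum p (f_ n)) @ U --> L ->
  (fun n => lpsum p (fun x => f_ n x - f x)) @ U --> B ->
  L = lpsum p f + B.
Proof.
move=> p0 ff fnp fp fL fB.
pose w n x := f_ n x - f x.
have wp n : in_lp p (w n) by exact: in_lpB.
have nfp := in_lpN fp.
have nfFE F : \sum_(x <- F) `|- f x| `^ p = \sum_(x <- F) `|f x| `^ p.
  by under eq_bigr do rewrite normrN.
have fF F := cvg_lp_partial F p0 ff.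
have wF F : (fun n => \sum_(x <- F) `|w n x| `^ p) @ U --> (0 : R).
  have w0 x : w ^~ x @ U --> (0 : R).
    by rewrite -(subrr (f x)); apply: cvgB; [exact: ff|exact: cvg_cst].
  have := @cvg_lp_partial p w (fun=> 0) F p0 w0.
  by rewrite [X in _ --> X]big1// => x _; rewrite normr0 powR0 ?gt_eqF.
have B0 : 0 <= B by apply: (cvgr_to_ge fB); apply: nearW => n; exact: lpsum_ge0.
have fLF F : (fun n => lpsum p (f_ n) - \sum_(x <- F) `|f_ n x| `^ p) @ U -->
    L - \sum_(x <- F) `|f x| `^ p by apply: cvgB.
have wBF F : (fun n => lpsum p (w n) - \sum_(x <- F) `|w n x| `^ p) @ U --> B - 0.
  by apply: cvgB.
have LF0 F : 0 <= L - \sum_(x <- F) `|f x| `^ p.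
  apply: (cvgr_to_ge (fLF F)); apply: nearW => n.
  by rewrite subr_ge0 le_lpsum.
have Lf0 : 0 <= L - lpsum p f.
  rewrite subr_ge0.
  by have [] : in_lp p f /\ lpsum p f <= L by apply: lpsum_le => F; rewrite -subr_ge0.
apply/eqP; rewrite addrC -subr_eq; apply/eqP.
have tail_small (c e : R) : 0 < c -> 0 < e ->
    exists F, c * (lpsum p f - \sum_(x <- F) `|f x| `^ p) < e.
  move=> c0 e0; have [F hF] := lpsum_approx fp (divr_gt0 e0 c0).
  exists F; rewrite mulrC -ltr_pdivlMr//; lra.
apply: le_anti; apply/andP; split; apply: le_of_le_mul => // rho rho1;
  have [C C0 ineq] := powR_normD_le p0 rho1; have rho0 : 0 < rho by lra.
  apply/ler_addgt0Pr => e e0.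
  have [F hF] := tail_small C e C0 e0.
  have : L - \sum_(x <- F) `|f x| `^ p <=
      rho * (B - 0) + C * (lpsum p f - \sum_(x <- F) `|f x| `^ p).
    have cv : (fun n => rho * (lpsum p (w n) - \sum_(x <- F) `|w n x| `^ p) +
       C * (lpsum p f - \sum_(x <- F) `|f x| `^ p)) @ U -->
       rho * (B - 0) + C * (lpsum p f - \sum_(x <- F) `|f x| `^ p).
      by apply: cvgD; [apply: cvgMl_tmp; exact: wBF|exact: cvg_cst].
    apply: (le_cvg (fLF F) cv) => n.
    have [] // := @tail_normD_le _ _ p rho C (w n) f (f_ n) F C0 rho0 ineq.
    by move=> x; rewrite /w subrK.
  rewrite subr0 => h; apply: le_trans (le_trans h _).
    by rewrite lerD2l lerN2 le_lpsum.
  by rewrite lerD2l ltW.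
apply/ler_addgt0Pr => e e0.
have [F hF] := tail_small (C + rho) e (addr_gt0 C0 rho0) e0.
have : B - 0 <= rho * (L - \sum_(x <- F) `|f x| `^ p) +
     C * (lpsum p f - \sum_(x <- F) `|f x| `^ p).
  have cv : (fun n => rho * (lpsum p (f_ n) - \sum_(x <- F) `|f_ n x| `^ p) +
       C * (lpsum p f - \sum_(x <- F) `|f x| `^ p)) @ U -->
       rho * (L - \sum_(x <- F) `|f x| `^ p) +
       C * (lpsum p f - \sum_(x <- F) `|f x| `^ p).
    by apply: cvgD; [apply: cvgMl_tmp; exact: fLF|exact: cvg_cst].
  apply: (le_cvg (wBF F) cv) => n.
  have [] // := @tail_normD_le _ _ p rho C (f_ n) (fun x => - f x) (w n) F C0 rho0 ineq.
  by rewrite lpsumN nfFE.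
rewrite subr0 => h; apply: le_trans h _; nra.
Qed.

End BrezisLieb.

Section Scaling.
Variables (R : realType) (G : groupType).

Lemma lpsum_scale_le p (c : R) (u : G -> R) : 0 <= c -> in_lp p u ->
  in_lp p (fun x => c * u x) /\ lpsum p (fun x => c * u x) <= c `^ p * lpsum p u.
Proof.
move=> c0 up; apply: lpsum_le => F.
under eq_bigr do rewrite normrM powRM// (ger0_norm c0).
by rewrite -mulr_sumr ler_wpM2l ?powR_ge0// le_lpsum.
Qed.

Lemma lpsum_scale p (c : R) (u : G -> R) : 0 < c -> in_lp p u ->
  lpsum p (fun x => c * u x) = c `^ p * lpsum p u.
Proof.
move=> c0 up; have [cup le1] := lpsum_scale_le (ltW c0) up.
have c10 : 0 < c^-1 by rewrite invr_gt0.
have [_] := lpsum_scale_le (ltW c10) cup.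
rewrite (_ : (fun x => c^-1 * (c * u x)) = u); last first.
  by apply/funext => x; rewrite mulKf ?gt_eqF.
rewrite -powR_inv1 ?(ltW c0)// powRAC powR_inv1 ?powR_ge0// => le2.
apply: le_anti; rewrite le1/= mulrC -ler_pdivlMr ?powR_gt0//.
by rewrite mulrC.
Qed.
End Scaling.

(** * Homogeneity of the Sobolev quotient *)

Section LaplacianLinear.
Variables (R : realType) (G : groupType) (S : set G).
Hypothesis finS : finite_set S.
Implicit Types (u v : G -> R).

Lemma laplacian_translate u y :
  laplacian S (fun x => u (y * x)%g) = fun x => laplacian S u (y * x)%g.
Proof.
by apply/funext => x; rewrite !laplacianE//; apply: eq_bigr => s _; rewrite mulgA.
Qed.

Lemma laplacianB u v :
  laplacian S (fun x => u x - v x) = fun x => laplacian S u x - laplacian S v x.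
Proof.
apply/funext => x; rewrite !laplacianE// -sumrB; apply: eq_bigr => s _; ring.
Qed.

Lemma laplacianZ c u : laplacian S (fun x => c * u x) = fun x => c * laplacian S u x.
Proof.
apply/funext => x; rewrite !laplacianE// mulr_sumr; apply: eq_bigr => s _; ring.
Qed.

End LaplacianLinear.

Section SobolevQuotient.
Variables (R : realType) (G : groupType) (S : set G) (N : nat) (p q : R).
Hypotheses (finS : finite_set S) (p_gt0 : 0 < p) (q_gt0 : 0 < q).
Hypothesis crit_gt0 : 0 < critical_exponent N p.
Implicit Types (u v : G -> R).

Lemma D2spaceP u :
  D2space S N p u <-> in_lp (critical_exponent N p) u /\ in_lp p (laplacian S u).
Proof. by rewrite /D2space/= /D2norm !in_lpP. Qed.

Lemma sobolev_inf_le u : D2space S N p u -> in_lp q u -> lpsum q u = 1 ->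
  (sobolev_inf S N p q <= (lpsum p (laplacian S u))%:E)%E.
Proof.
move=> uD uq u1; apply: ereal_inf_lbound; exists u.
  by split => //; apply/lpnorm_eq1.
by have [_ up] := (D2spaceP u).1 uD; rewrite /D2norm lpnorm_powE.
Qed.

(** The constraint |u|_q = 1 is removed by homogeneity. *)
Lemma sobolev_inf_scaled u K : sobolev_inf S N p q = K%:E ->
  D2space S N p u -> in_lp q u ->
  K * lpsum q u `^ (p / q) <= lpsum p (laplacian S u).
Proof.
move=> KE /D2spaceP[us up] uq.
have := lpsum_ge0 q u; rewrite le_eqVlt => /predU1P[<-|a0].
  by rewrite powR0 ?mulr0 ?lpsum_ge0// mulf_neq0 ?invr_neq0 ?gt_eqF.
set a := lpsum q u in a0 *; pose c := a `^ (- q^-1).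
have c0 : 0 < c by rewrite powR_gt0.
pose w x := c * u x.
have wq : in_lp q w by case: (lpsum_scale_le (ltW c0) uq).
have wD : D2space S N p w.
  apply/D2spaceP; split; first by case: (lpsum_scale_le (ltW c0) us).
  by rewrite laplacianZ//; case: (lpsum_scale_le (ltW c0) up).
have w1 : lpsum q w = 1.
  rewrite lpsum_scale// -/a /c -powRrM mulNr mulVf ?gt_eqF// powR_inv1 ?(ltW a0)//.
  by rewrite mulVf ?gt_eqF.
have := sobolev_inf_le wD wq w1; rewrite KE lee_fin laplacianZ// lpsum_scale//.
rewrite /c -powRrM mulNr powRN mulrC ler_pdivlMr ?powR_gt0//.
by rewrite (mulrC q^-1).
Qed.

Lemma sobolev_inf_ge b : (forall u, D2space S N p u -> in_lp q u ->
    lpsum q u = 1 -> b <= lpsum p (laplacian S u)) ->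
  (b%:E <= sobolev_inf S N p q)%E.
Proof.
move=> hb; apply: le_ereal_inf_tmp => _ [u [uD /lpnorm_eq1[]// uq u1] <-].
have [_ up] := (D2spaceP u).1 uD.
by rewrite /D2norm lpnorm_powE// lee_fin; exact: hb.
Qed.

End SobolevQuotient.

(** * Nonvanishing and existence of a minimizer *)

Section Concentration.
Variables (R : realType) (G : groupType).
Implicit Types (u : G -> R).

Lemma lpsum1_norm_le1 (q : R) u x : 0 < q -> in_lp q u -> lpsum q u = 1 ->
  `|u x| <= 1.
Proof.
move=> q0 uq u1; have := lpterm_le x uq; rewrite u1 => h.
rewrite leNgt; apply/negP => ux; move: h; rewrite leNgt => /negP; apply.
have : 1 `^ q < `|u x| `^ q; last by rewrite powR1.
by apply: gt0_ltr_powR; rewrite ?nnegrE.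
Qed.

(** l^sigma embeds in l^q for sigma < q: as |u| <= 1, one has
    |u|^q <= |u|^sigma. *)
Lemma lpsum_embedding (sigma q : R) u : 0 < sigma -> sigma < q ->
  in_lp sigma u -> in_lp q u -> lpsum q u = 1 -> 1 <= lpsum sigma u.
Proof.
move=> s0 sq us uq u1; rewrite -u1.
have [] // : in_lp q u /\ lpsum q u <= lpsum sigma u.
apply: lpsum_le => F; apply: le_trans (le_lpsum F us).
apply: ler_sum => x _; have [->|ux] := eqVneq (u x) 0.
  by rewrite normr0 !powR0 ?gt_eqF//; lra.
apply: ger_powR; last exact: ltW.
by rewrite normr_gt0 ux (lpsum1_norm_le1 _ _ uq u1)//; lra.
Qed.

(** From |u|^q <= (sup |u|)^(q - sigma) |u|^sigma: if |u| were below c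
    everywhere, the l^q mass would be less than 1. *)
Lemma nonvanishing (sigma q M : R) : 0 < sigma -> sigma < q -> 0 <= M ->
  exists2 c : R, 0 < c & forall u, in_lp sigma u -> in_lp q u ->
    lpsum q u = 1 -> lpsum sigma u <= M -> exists x, c <= `|u x|.
Proof.
move=> s0 sq M0; pose b := (M + 1)^-1; pose c := b `^ (q - sigma)^-1.
have b0 : 0 < b by rewrite invr_gt0; lra.
have c0 : 0 < c by rewrite powR_gt0.
have qs0 : 0 < q - sigma by lra.
have cb : c `^ (q - sigma) = b.
  by rewrite -powRrM mulVf ?gt_eqF// powRr1// ltW.
exists c => // u us uq u1 uM; apply: contrapT => h.
have uc x : `|u x| <= c.
  by rewrite leNgt; apply/negP => cu; apply: h; exists x; exact: ltW.
have [_] : in_lp q u /\ lpsum q u <= b * M.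
  apply: lpsum_le => F.
  apply: (@le_trans _ _ (b * \sum_(x <- F) `|u x| `^ sigma)); last first.
    by rewrite ler_pM2l//; apply: le_trans uM; exact: le_lpsum.
  rewrite mulr_sumr; apply: ler_sum => x _.
  have -> : q = (q - sigma) + sigma by rewrite subrK.
  rewrite powRD; last by apply/implyP => /eqP; lra.
  rewrite ler_wpM2r ?powR_ge0// -cb.
  by rewrite ge0_ler_powR ?nnegrE ?(ltW c0) ?(ltW qs0) ?uc.
rewrite u1 /b mulrC ler_pdivlMr; lra.
Qed.

(** x^theta >= x on [0,1], with equality only at 0 and 1.  This strict
    concavity excludes the splitting of mass of a minimizing sequence. *)
Lemma powR_sum_le1_eq1 (a b theta : R) : 0 < theta < 1 -> 0 < a -> 0 <= b ->
  a + b = 1 -> a `^ theta + b `^ theta <= 1 -> a = 1.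
Proof.
move=> /andP[t0 t1] a0 b0 ab h.
apply/eqP; rewrite eq_le; apply/andP; split; first lra.
rewrite leNgt; apply/negP => a1.
have : b <= b `^ theta.
  have [->|bn] := eqVneq b 0; first by exact: powR_ge0.
  apply: ger1_powR; last exact: ltW.
  by apply/andP; split; [rewrite lt0r bn|lra].
suff : a < a `^ theta by lra.
have {1}-> : a = a `^ theta * a `^ (1 - theta).
  rewrite -powRD; last by rewrite (gt_eqF a0) implybT.
  by rewrite addrC subrK powRr1// ltW.
rewrite gtr_pMr ?powR_gt0//.
have : a `^ (1 - theta) < 1 `^ (1 - theta); last by rewrite powR1.
by apply: gt0_ltr_powR; rewrite ?nnegrE; lra.
Qed.

End Concentration.

Theorem theorem1 (R : realType) (G : groupType) (S : set G) (N : nat) (p q : R)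
  (u_ : nat -> G -> R)
  (finS : finite_set S) (symS : symmetric_set S) (genS : generating S)
  (growthS : polynomial_growth R S N) (N3 : (3 <= N)%N)
  (p_gt1 : 1 < p) (p_ltN2 : p < N%:R / 2) (q_gt : critical_exponent N p < q)
  (u_D2 : forall n, D2space S N p (u_ n))
  (u_norm : forall n, lpnorm q (u_ n) = 1%E)
  (u_min : (fun n => (D2norm S p (u_ n) `^ p)%E) @ \oo --> sobolev_inf S N p q) :
  exists (x_ : nat -> G) (v : G -> R),
    [/\ D2space S N p v,
        exists2 phi : nat -> nat, {homo phi : m n / (m < n)%N} &
          (fun k => D2norm S p
             (fun x => u_ (phi k) (x_ (phi k) * x)%g - v x)) @ \oo --> 0%E,
        lpnorm q v = 1%E &
        (D2norm S p v `^ p)%E = sobolev_inf S N p q].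
Proof.
have N0 : (0 < N)%N by apply: leq_trans N3.
have N0' : 0 < N%:R :> R by rewrite ltr0n.
have p0 : 0 < p by lra.
have d0 : 0 < N%:R - 2 * p by lra.
set sigma := critical_exponent N p in q_gt.
have s0 : 0 < sigma by rewrite divr_gt0// mulr_gt0.
have ps : p < sigma.
  rewrite /sigma /critical_exponent ltr_pdivlMr// mulrC ltr_pM2r//; lra.
have q0 : 0 < q by lra.
have pq : 0 < p / q < 1 by rewrite divr_gt0//= ltr_pdivrMr//; lra.
have [C C0 sob] := sobolev_inequality finS symS growthS N0 p_gt1 p_ltN2.
rewrite -/sigma in sob.
have DP := D2spaceP S p0 s0.
have us n : in_lp sigma (u_ n) by case/DP: (u_D2 n).
have up n : in_lp p (laplacian S (u_ n)) by case/DP: (u_D2 n).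
have uq n : in_lp q (u_ n) by have [] := (lpnorm_eq1 (u_ n) q0).1 (u_norm n).
have u1 n : lpsum q (u_ n) = 1 by have [] := (lpnorm_eq1 (u_ n) q0).1 (u_norm n).
have K_ge : ((C^-1)%:E <= sobolev_inf S N p q)%E.
  apply: sobolev_inf_ge => // u /DP[uus uup] uuq uu1.
  rewrite -[leLHS]mulr1 mulrC ler_pdivrMr// mulrC.
  apply: le_trans (sob _ uus uup).
  have := lpsum_embedding s0 q_gt uus uuq uu1.
  move=> h; have : 1 `^ (p / sigma) <= lpsum sigma u `^ (p / sigma); last by rewrite powR1.
  by apply: ge0_ler_powR; rewrite ?nnegrE ?lpsum_ge0// divr_ge0// ltW.
have K_fin : sobolev_inf S N p q \is a fin_num.
  rewrite fin_numElt; apply/andP; split.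
    by apply: lt_le_trans K_ge; exact: ltNyr.
  apply: le_lt_trans (sobolev_inf_le p0 q0 s0 (u_D2 0%N) (uq 0%N) (u1 0%N)) _.
  exact: ltry.
pose K := fine (sobolev_inf S N p q).
have KE : sobolev_inf S N p q = K%:E by rewrite fineK.
have K0 : 0 < K.
  by rewrite -lte_fin -KE; apply: lt_le_trans K_ge; rewrite lte_fin invr_gt0.
have uK : (fun n => lpsum p (laplacian S (u_ n))) @ \oo --> K.
  move: u_min; rewrite KE => /fine_cvg; apply: cvg_trans.
  apply: near_eq_cvg; apply: nearW => n.
  by rewrite /= /D2norm lpnorm_powE.
pose M := (C * (K + 1)) `^ (sigma / p).
have M0 : 0 <= M by exact: powR_ge0.
have uM n : lpsum p (laplacian S (u_ n)) <= K + 1 -> lpsum sigma (u_ n) <= M.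
  move=> h; have -> : lpsum sigma (u_ n) =
      (lpsum sigma (u_ n) `^ (p / sigma)) `^ (sigma / p).
    rewrite -powRrM (_ : p / sigma * (sigma / p) = 1).
      by rewrite powRr1// lpsum_ge0.
    by field; rewrite !gt_eqF.
  apply: ge0_ler_powR; rewrite ?nnegrE ?powR_ge0//.
    by rewrite divr_ge0// ltW.
    by rewrite mulr_ge0//; lra.
  by apply: le_trans (sob _ (us n) (up n)) _; rewrite ler_pM2l.
have [c c0 nonv] := nonvanishing G s0 q_gt M0.
have pick_x n : exists x, lpsum p (laplacian S (u_ n)) <= K + 1 -> c <= `|u_ n x|.
  have [h|h] := leP (lpsum p (laplacian S (u_ n))) (K + 1).
    by have [x xc] := nonv _ (us n) (uq n) (u1 n) (uM n h); exists x.
  (* Default value, taken by finitely many indices only. *)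
  by exists 1%g; lra.
have [x_ x_P] := choice pick_x.
pose v_ n x := u_ n (x_ n * x)%g.
have vs n : in_lp sigma (v_ n) by exact: in_lp_translate.
have vq n : in_lp q (v_ n) by exact: in_lp_translate.
have v1 n : lpsum q (v_ n) = 1 by rewrite (lpsum_translate q (u_ n)).
have LvE n : laplacian S (v_ n) = fun x => laplacian S (u_ n) (x_ n * x)%g.
  exact: laplacian_translate.
have vp n : in_lp p (laplacian S (v_ n)).
  by rewrite LvE; exact: in_lp_translate.
have vLE n : lpsum p (laplacian S (v_ n)) = lpsum p (laplacian S (u_ n)).
  by rewrite LvE (lpsum_translate p (laplacian S (u_ n))).
have vsE n : lpsum sigma (v_ n) = lpsum sigma (u_ n).
  exact: (lpsum_translate sigma (u_ n)).
(* Along an ultrafilter every bounded sequence converges, so that all limits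
   below exist simultaneously. *)
have [U [UU ooU]] := ultraFilterLemma eventually_filter.
have UP : ProperFilter U by exact: ultra_proper.
have toU (f : nat -> R) l : f @ \oo --> l -> f @ U --> l.
  by move=> fl V /fl; exact: ooU.
have Kev : U [set n | lpsum p (laplacian S (u_ n)) <= K + 1].
  by apply: ooU; apply: (cvgr_le _ uK); rewrite ltrDl.
have v_lim x : exists l : R, v_ ^~ x @ U --> l.
  apply: (@bounded_ultra_cvg _ _ _ _ 1) => //.
  apply: filterE => n /=; exact: lpsum1_norm_le1 q0 (vq n) (v1 n).
have [v vP] := choice v_lim.
have LvP x : (fun n => laplacian S (v_ n) x) @ U --> laplacian S v x.
  rewrite laplacianE//; under eq_fun do rewrite laplacianE//.
  apply: (@cvg_seq_sum _ _ _ _ _ _ (fun n s => v_ n (x * s)%g - v_ n x)) => s.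
  by apply: cvgB; exact: vP.
have [v_s _] : in_lp sigma v /\ lpsum sigma v <= M.
  apply: lpsum_fatou s0 vP _; apply: filterS Kev => n /= h.
  by split; [exact: vs|rewrite vsE uM].
have [v_q _] : in_lp q v /\ lpsum q v <= 1.
  by apply: lpsum_fatou q0 vP _; apply: filterE => n /=; rewrite v1.
have [v_p _] : in_lp p (laplacian S v) /\ lpsum p (laplacian S v) <= K + 1.
  apply: lpsum_fatou p0 LvP _; apply: filterS Kev => n /= h.
  by split; [exact: vp|rewrite vLE].
have vD : D2space S N p v by apply/DP.
pose w n x := v_ n x - v x.
have ws n : in_lp sigma (w n) by exact: in_lpB.
have wq n : in_lp q (w n) by exact: in_lpB.
have LwE n : laplacian S (w n) = fun x => laplacian S (v_ n) x - laplacian S v x.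
  exact: laplacianB.
have wp n : in_lp p (laplacian S (w n)) by rewrite LwE; exact: in_lpB.
have wD n : D2space S N p (w n) by apply/DP.
have lim_diff (r B : R) (f_ : nat -> G -> R) (f : G -> R) : 0 < r ->
    (forall n, in_lp r (f_ n)) -> in_lp r f -> U [set n | lpsum r (f_ n) <= B] ->
    exists l : R, (fun n => lpsum r (fun x => f_ n x - f x)) @ U --> l.
  move=> r0 fr fr' fB.
  have [D D0 ineq] := lpsumB_le G r0.
  apply: (@bounded_ultra_cvg _ _ _ _ (2 * B + D * lpsum r f)) => //.
  apply: filterS fB => n /= fnB; rewrite ger0_norm ?lpsum_ge0//.
  have [_] := ineq _ _ (fr n) fr'.
  by move=> /le_trans; apply; rewrite lerD2r ler_pM2l.
have vB : U [set n | lpsum q (v_ n) <= 1] by apply: filterE => n /=; rewrite v1.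
have [beta wbeta] := lim_diff q 1 v_ v q0 vq v_q vB.
have [E wE] : exists E : R, (fun n => lpsum p (laplacian S (w n))) @ U --> E.
  rewrite (_ : (fun n => _) = fun n => lpsum p (fun x =>
      laplacian S (v_ n) x - laplacian S v x)); last first.
    by apply/funext => n; rewrite LwE.
  apply: (lim_diff p (K + 1)) => //.
  by apply: filterS Kev => n /=; rewrite vLE.
have beta0 : 0 <= beta.
  by apply: (cvgr_to_ge wbeta); apply: nearW => n; exact: lpsum_ge0.
have E0 : 0 <= E.
  by apply: (cvgr_to_ge wE); apply: nearW => n; exact: lpsum_ge0.
set alpha := lpsum q v.
have bl_q : 1 = alpha + beta.
  apply: (brezis_lieb q0 vP vq v_q _ wbeta).
  by under eq_fun do rewrite v1; exact: cvg_cst.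
have bl_p : K = lpsum p (laplacian S v) + E.
  apply: (brezis_lieb p0 LvP vp v_p).
    by under eq_fun do rewrite vLE; exact: toU.
  by under eq_fun do rewrite -LwE.
have Ka := sobolev_inf_scaled finS p0 q0 s0 KE vD v_q.
have Kb : K * beta `^ (p / q) <= E.
  have cvb : (fun n => K * lpsum q (w n) `^ (p / q)) @ U --> K * beta `^ (p / q).
    apply: cvgMl_tmp; apply: cvg_powR => //; first by case/andP: pq.
    by move=> n; exact: lpsum_ge0.
  apply: (le_cvg cvb wE) => n.
  have h := sobolev_inf_scaled finS p0 q0 s0 KE (wD n) (wq n). exact: h.
(* By the choice of the translations, |v_n| >= c at the unit for all large n. *)
have alpha0 : 0 < alpha.
  have cv1 : c <= `|v 1%g|.
    apply: (cvgr_to_ge (cvg_norm (vP 1%g))); apply: filterS Kev => n /= h.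
    by rewrite /v_ mulg1; exact: x_P.
  apply: lt_le_trans (lpterm_le 1%g v_q); rewrite powR_gt0//; lra.
(* Add Ka and Kb, use K = D + E, and divide by K. *)
have alpha1 : alpha = 1.
  apply: (powR_sum_le1_eq1 pq alpha0 beta0); first by rewrite -bl_q.
  by rewrite -(ler_pM2l K0) mulrDr mulr1 [leRHS]bl_p lerD.
have KD : lpsum p (laplacian S v) = K.
  move: Ka; rewrite -/alpha alpha1 powR1 mulr1 => Ka.
  by apply/eqP; rewrite eq_le Ka andbT bl_p lerDl.
have E_0 : E = 0 by lra.
exists x_, v; split => //.
- have cv0 : (fun n => lpsum p (laplacian S (w n)) `^ p^-1) @ U --> (0 : R).
    rewrite -[X in _ --> X](@powR0 R p^-1) ?invr_neq0 ?gt_eqF// -E_0.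
    apply: cvg_powR => //; first by rewrite invr_gt0.
    by move=> n; exact: lpsum_ge0.
  have [phi phi_inc phi0] := extract_subsequence UP ooU cv0.
  exists phi => //.
  apply: (@cvg_trans _ ((fun k => (lpsum p (laplacian S (w (phi k))) `^ p^-1)%:E) @ \oo)).
    apply: near_eq_cvg; apply: nearW => k.
    by rewrite /D2norm -lpnormE.
  apply: cvg_EFin; first by apply: nearW => k; rewrite fin_numE.
  exact: phi0.
- by apply/lpnorm_eq1.
- by rewrite /D2norm lpnorm_powE// KD KE.
Qed.
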